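(* Let $f:SG'\times SG''\to\mathbb{R}$ be the fractal interpolation function determined by a data set $\{(y,z_y):y\in V_N\}$ and functions $\alpha_{\omega\eta},h_{\omega\eta}$ ($\omega,\eta\in I^N$), as described in the context. Let $h_{\omega\eta}$ and $\alpha_{\omega\eta}$ ($\omega,\eta\in I^N$) be Hölder continuous functions with constants $K_h$, $K_\alpha$ and Hölder exponents $s_h$, $s_{\alpha_{\omega\eta}}$ respectively. Put $\|\alpha\|_\infty=\max\{\|\alpha_{\omega\eta}\|_\infty:\omega,\eta\in I^N\}$, $s_\alpha=\min\{s_{\alpha_{\omega\eta}}:\omega,\eta\in I^N\}$ and $s=\min\{s_h,s_\alpha\}$. If $\|\alpha\|_\infty<\frac1{2^N}$, then $$2\,\frac{\log 3}{\log 2}\le\dim_H(Gr(f))\le\overline{\dim}_B(Gr(f))\le 1-s+2\,\frac{\log3}{\log2},$$ where $Gr(f)=\{(t,s,f(t,s)):(t,s)\in SG'\times SG''\}$ is the graph of $f$, $\dim_H$ denotes Hausdorff dimension and $\overline{\dim}_B$ denotes upper box dimension.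
   Context: Let $I=\{1,2,3\}$ and $N\ge1$. Let $U_0=\{p_1,p_2,p_3\}$ be the vertices of an equilateral triangle in $\mathbb{R}^2$ and $L_i(t)=\frac12(t+p_i)$, $i\in I$; let $W_0=\{q_1,q_2,q_3\}$ be the vertices of an equilateral triangle in another copy of $\mathbb{R}^2$ and $K_i(s)=\frac12(s+q_i)$, $i\in I$. $SG'$ and $SG''$ are the Sierpiński gaskets, i.e. the unique nonempty compact sets with $SG'=\bigcup_{i\in I}L_i(SG')$ and $SG''=\bigcup_{i\in I}K_i(SG'')$. It is assumed that $\|(t,s)-(t',s')\|_2\le1$ for all $(t,s),(t',s')\in SG'\times SG''$. For a word $\omega=\omega_1\omega_2\cdots\omega_N\in I^N$ put $L_\omega=L_{\omega_1}\circ\cdots\circ L_{\omega_N}$ and $K_\omega=K_{\omega_1}\circ\cdots\circ K_{\omega_N}$. Put $V_N=\{(L_\omega(p_i),K_\eta(q_j)):\omega,\eta\in I^N,\ i,j\in I\}$. $\|\cdot\|_\infty$ is the sup norm on $SG'\times SG''$. Data and parameters: real numbers $z_y$ ($y\in V_N$) that are zero on the boundary $(U_0\times SG'')\cup(SG'\times W_0)$; continuous functions $\alpha_{\omega\eta}:SG'\times SG''\to\mathbb{R}$ with $\|\alpha_{\omega\eta}\|_\infty<1$; functions $h_{\omega\eta}:SG'\times SG''\to\mathbb{R}$ such that (M1) for $\omega=\omega_1\omega_2\cdots\omega_{N-1}i$ and $\tau=\omega_1\omega_2\cdots\omega_{N-1}j$, $h_{\omega\eta}(p_j,s)=h_{\tau\eta}(p_i,s)$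 for all $s\in SG''$; (M2) for $\eta=\eta_1\eta_2\cdots\eta_{N-1}i$ and $\xi=\eta_1\eta_2\cdots\eta_{N-1}j$, $h_{\omega\eta}(t,q_j)=h_{\omega\xi}(t,q_i)$ for all $t\in SG'$; (M3) for $\omega=\omega_1\cdots\omega_{N-1}i$, $\tau=\omega_1\cdots\omega_{N-1}j$, $\eta=\eta_1\cdots\eta_{N-1}k$ and $\xi=\eta_1\cdots\eta_{N-1}l$, $h_{\omega\eta}(p_j,q_l)=h_{\tau\xi}(p_i,q_k)$, for all $i,j,k,l\in I$. The fractal interpolation function $f$ is the continuous function $f:SG'\times SG''\to\mathbb{R}$ with $f(y)=z_y$ for all $y\in V_N$ whose graph is the attractor (unique nonempty compact invariant set) of the system of maps $W_{\omega\eta}(t,s,x)=(L_\omega(t),K_\eta(s),\alpha_{\omega\eta}(t,s)x+h_{\omega\eta}(t,s))$, $\omega,\eta\in I^N$, on $SG'\times SG''\times\mathbb{R}$. It satisfies $f(L_\omega(t),K_\eta(s))=\alpha_{\omega\eta}(t,s)f(t,s)+h_{\omega\eta}(t,s)$ for all $(t,s)\in SG'\times SG''$ and $\omega,\eta\in I^N$. A function $g:SG'\times SG''\to\mathbb{R}$ is Hölder continuous with constant $C$ and exponent $\beta$ if $|g(t,s)-g(t',s')|\le C\|(t,s)-(t',s')\|_2^{\beta}$ for all points $(t,s),(t',s')\in SG'\times SG''$. The exponents $s_h$, $s_{\alpha_{\omega\eta}}$ in the hypotheses are in $(0,1]$. The graph $Gr(f)$ is regarded as a subset of $\mathbb{R}^2\times\mathbb{R}^2\times\mathbb{R}=\mathbb{R}^5$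 with the Euclidean metric. In the bound $1-s+2\frac{\log 3}{\log 2}$ the letter $s$ denotes the number $\min\{s_h,s_\alpha\}$, not a point of $SG''$. *)

(* Defs.v *)
From HB Require Import structures.
From mathcomp Require Import all_boot all_order all_algebra.
From mathcomp Require Import all_classical all_reals all_analysis.

Set Implicit Arguments.
Unset Strict Implicit.
Unset Printing Implicit Defensive.

Import Order.TTheory GRing.Theory Num.Theory.
Import numFieldNormedType.Exports.

Local Open Scope classical_set_scope.
Local Open Scope ring_scope.

(* The library norm on row vectors is the sup norm (it induces the usual
   topology); distances are measured with the Euclidean norm below. *)
Definition eucl_norm (R : realType) (n : nat) (x : 'rV[R]_n) : R :=
  Num.sqrt (\sum_(i < n) x ord0 i ^+ 2).

Definition eucl_dist (R : realType) (n : nat) (x y : 'rV[R]_n) : R := eucl_norm (x - y).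

(* -oo for the empty set *)
Definition ediam (R : realType) (n : nat) (U : set 'rV[R]_n) : \bar R :=
  ereal_sup [set (eucl_dist z.1 z.2)%:E | z in U `*` U].

(* Empty sets are left out of the sum: they contribute 0 also for d = 0. *)
Definition hausdorff_content (R : realType) (n : nat) (d delta : R)
    (A : set 'rV[R]_n) : \bar R :=
  ereal_inf [set (\sum_(0 <= i <oo | U i != set0) (ediam (U i) `^ d))%E
            | U in [set U : nat -> set 'rV[R]_n |
                A `<=` \bigcup_i U i /\
                forall i, (ediam (U i) <= delta%:E)%E]].

Definition hausdorff_measure (R : realType) (n : nat) (d : R)
    (A : set 'rV[R]_n) : \bar R :=
  ereal_sup [set hausdorff_content d delta A | delta in [set x : R | 0 < x]].

Definition hausdorff_dim (R : realType) (n : nat) (A : set 'rV[R]_n) : \bar R :=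
  ereal_inf [set d%:E | d in [set d : R | 0 <= d /\ hausdorff_measure d A = 0%E]].

(* The least number of sets of diameter at most delta that cover A; it is +oo
   when A has no finite such cover. *)
Definition covering_number (R : realType) (n : nat) (A : set 'rV[R]_n)
    (delta : R) : \bar R :=
  ereal_inf [set k%:R%:E | k in [set k : nat |
    exists U : 'I_k -> set 'rV[R]_n,
      A `<=` \bigcup_i U i /\ forall i, (ediam (U i) <= delta%:E)%E]].

Definition upper_box_dim (R : realType) (n : nat) (A : set 'rV[R]_n) : \bar R :=
  limf_esup (fun delta : R => (lne (covering_number A delta) * (- ln delta)^-1%:E)%E)
            (0 : R)^'+.

Definition invariant_set (T I : Type) (F : I -> T -> T) (A : set T) : Prop :=
  A = \bigcup_i (F i @` A).

(* A is the unique nonempty compact subset of D that is invariant under F. *)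
Definition is_attractor (T : topologicalType) (I : Type) (D : set T)
    (F : I -> T -> T) (A : set T) : Prop :=
  [/\ A `<=` D, A !=set0, compact A, invariant_set F A &
      forall B : set T, B `<=` D -> B !=set0 -> compact B ->
        invariant_set F B -> B = A].

Definition equilateral (R : realType) (p : 'I_3 -> 'rV[R]_2) : Prop :=
  exists2 l : R, 0 < l & forall i j : 'I_3, i != j -> eucl_dist (p i) (p j) = l.

Definition half_map (R : realType) (p : 'I_3 -> 'rV[R]_2) (i : 'I_3)
  (t : 'rV[R]_2) : 'rV[R]_2 := 2^-1 *: (t + p i).

Definition is_gasket (R : realType) (p : 'I_3 -> 'rV[R]_2)
    (SG : set 'rV[R]_2) : Prop :=
  is_attractor [set: 'rV[R]_2] (half_map p) SG.

Definition word (N : nat) : Type := N.-tuple 'I_3.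

(* The first letter of the word is the outermost map. *)
Definition word_map (R : realType) (p : 'I_3 -> 'rV[R]_2) (N : nat)
  (w : word N) (t : 'rV[R]_2) : 'rV[R]_2 := foldr (half_map p) t w.

Definition pdist (R : realType) (x y : 'rV[R]_2 * 'rV[R]_2) : R :=
  eucl_dist (row_mx x.1 x.2) (row_mx y.1 y.2).

Definition vertices (R : realType) (p q : 'I_3 -> 'rV[R]_2) (N : nat) :
    set ('rV[R]_2 * 'rV[R]_2) :=
  [set y | exists (w e : word N) (i j : 'I_3),
     y = (word_map p w (p i), word_map q e (q j))].

Definition product_boundary (R : realType) (p q : 'I_3 -> 'rV[R]_2)
    (SG1 SG2 : set 'rV[R]_2) : set ('rV[R]_2 * 'rV[R]_2) :=
  (range p `*` SG2) `|` (SG1 `*` range q).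

Definition sup_norm (R : realType) (T : Type) (A : set T) (g : T -> R) : \bar R :=
  ereal_sup [set `|g x|%:E | x in A].

Definition hoelder_on (R : realType) (A : set ('rV[R]_2 * 'rV[R]_2))
    (g : 'rV[R]_2 * 'rV[R]_2 -> R) (C b : R) : Prop :=
  forall x y, A x -> A y -> `|g x - g y| <= C * pdist x y `^ b.

Definition matching1 (R : realType) (p : 'I_3 -> 'rV[R]_2)
    (SG2 : set 'rV[R]_2) (N : nat)
    (h : word N -> word N -> 'rV[R]_2 * 'rV[R]_2 -> R) : Prop :=
  forall (u : seq 'I_3) (i j : 'I_3) (w t e : word N),
    tval w = rcons u i -> tval t = rcons u j ->
    forall s, SG2 s -> h w e (p j, s) = h t e (p i, s).

Definition matching2 (R : realType) (q : 'I_3 -> 'rV[R]_2)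
    (SG1 : set 'rV[R]_2) (N : nat)
    (h : word N -> word N -> 'rV[R]_2 * 'rV[R]_2 -> R) : Prop :=
  forall (v : seq 'I_3) (i j : 'I_3) (w e x : word N),
    tval e = rcons v i -> tval x = rcons v j ->
    forall t, SG1 t -> h w e (t, q j) = h w x (t, q i).

Definition matching3 (R : realType) (p q : 'I_3 -> 'rV[R]_2) (N : nat)
    (h : word N -> word N -> 'rV[R]_2 * 'rV[R]_2 -> R) : Prop :=
  forall (u v : seq 'I_3) (i j k l : 'I_3) (w t e x : word N),
    tval w = rcons u i -> tval t = rcons u j ->
    tval e = rcons v k -> tval x = rcons v l ->
    h w e (p j, q l) = h t x (p i, q k).

Definition fif_map (R : realType) (p q : 'I_3 -> 'rV[R]_2) (N : nat)
    (alpha h : word N -> word N -> 'rV[R]_2 * 'rV[R]_2 -> R)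
    (we : word N * word N) (u : 'rV[R]_2 * 'rV[R]_2 * R) :
    'rV[R]_2 * 'rV[R]_2 * R :=
  ((word_map p we.1 u.1.1, word_map q we.2 u.1.2),
   alpha we.1 we.2 u.1 * u.2 + h we.1 we.2 u.1).

Definition graph_on (T U : Type) (A : set T) (f : T -> U) : set (T * U) :=
  [set (x, f x) | x in A].

Definition is_fif (R : realType) (p q : 'I_3 -> 'rV[R]_2)
    (SG1 SG2 : set 'rV[R]_2) (N : nat) (z : 'rV[R]_2 * 'rV[R]_2 -> R)
    (alpha h : word N -> word N -> 'rV[R]_2 * 'rV[R]_2 -> R)
    (f : 'rV[R]_2 * 'rV[R]_2 -> R) : Prop :=
  [/\ {within SG1 `*` SG2, continuous f},
      forall y, vertices p q N y -> f y = z y &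
      is_attractor ((SG1 `*` SG2) `*` [set: R]) (fif_map p q alpha h)
        (graph_on (SG1 `*` SG2) f)].

Definition to_space5 (R : realType) (u : 'rV[R]_2 * 'rV[R]_2 * R) :
  'rV[R]_(2 + 2 + 1) := row_mx (row_mx u.1.1 u.1.2) u.2%:M.

Definition Gr (R : realType) (SG1 SG2 : set 'rV[R]_2)
    (f : 'rV[R]_2 * 'rV[R]_2 -> R) : set 'rV[R]_(2 + 2 + 1) :=
  @to_space5 R @` graph_on (SG1 `*` SG2) f.

(* Starting the maximum at 0 is harmless: the sup norms are nonnegative. *)
Definition max_sup_norm (R : realType) (A : set ('rV[R]_2 * 'rV[R]_2)) (N : nat)
    (alpha : word N -> word N -> 'rV[R]_2 * 'rV[R]_2 -> R) : \bar R :=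
  \big[maxe/0%E]_(w : N.-tuple 'I_3) \big[maxe/0%E]_(e : N.-tuple 'I_3)
    sup_norm A (alpha w e).

(* Starting the minimum at 1 is harmless: the exponents are at most 1. *)
Definition min_exponent (R : realType) (N : nat)
    (b : word N -> word N -> R) : R :=
  \big[Num.min/1]_(w : N.-tuple 'I_3) \big[Num.min/1]_(e : N.-tuple 'I_3) b w e.

(* Main.v *)
Require Import Defs.
From mathcomp Require Import all_boot all_order all_algebra.
From mathcomp Require Import all_classical all_reals all_analysis.
From mathcomp Require Import zify ring lra.
Import Order.TTheory GRing.Theory Num.Theory.
Import numFieldNormedType.Exports.
Local Open Scope classical_set_scope.
Local Open Scope ring_scope.

(* Lower bound.  The level-k vertices of a gasket lie in a triangular lattice of
   step l / 2^k, so a set of diameter at most 2^-k in R^5 projects close to a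
   bounded number of pairs of words of length k.  A cover of the graph thus
   yields a family of words over the 9-letter alphabet; if sum diam^d were small
   for some d <= 2 log 3 / log 2, so would be the sum of 9^-|w|, and then
   some infinite address avoids all these words (Kraft's inequality).  The point
   of the product with that address is not covered.

   Upper bound.  Let rho = 2^-N.  Since |alpha| < rho <= rho^s, the
   self-referential equation gives oscillation at most C rho^(ns) for f on each
   of the 9^(nN) cells of level n.  Cutting the graph over a cell into slices of
   height rho^n covers the graph by O(9^(nN) rho^(n(s-1))) sets of diameter at
   most 2 rho^n, and 9^(nN) = rho^(-n D) with D = 2 log 3 / log 2.

   Distances enter only through squared norms, where
   |x + y|^2 <= 2 |x|^2 + 2 |y|^2 replaces the triangle inequality. *)

Set Implicit Arguments.
Unset Strict Implicit.
Unset Printing Implicit Defensive.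

(** * Geometric scales and squared Euclidean norms *)

Lemma geometric_bracket (R : realType) (r x : R) : 0 < r < 1 -> 0 < x <= 1 ->
  exists n, r ^+ n.+1 < x <= r ^+ n.
Proof.
move=> /andP[r0 r1] /andP[x0 x1].
have ex : exists n, r ^+ n < x.
  have : (fun n => r ^+ n) @ \oo --> (0 : R).
    by apply: cvg_expr; rewrite ger0_norm // ltW.
  move=> /cvgrPdist_lt /(_ x x0) [n _ /(_ n (leqnn n))] /=.
  by rewrite sub0r normrN ger0_norm ?exprn_ge0 ?ltW // => ?; exists n.
case: (ex_minnP ex) => -[|n].
  by rewrite expr0 => /lt_le_trans/(_ x1); rewrite ltxx.
move=> xn minn; exists n; rewrite xn /= leNgt; apply/negP => /minn.
by rewrite ltnn.
Qed.

Definition sqnorm (R : realType) (n : nat) (x : 'rV[R]_n) : R :=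
  \sum_(i < n) x ord0 i ^+ 2.

Lemma sqnorm_ge0 (R : realType) (n : nat) (x : 'rV[R]_n) : 0 <= sqnorm x.
Proof. by apply: sumr_ge0 => i _; exact: sqr_ge0. Qed.

Lemma eucl_dist_sqr (R : realType) (n : nat) (x y : 'rV[R]_n) :
  eucl_dist x y ^+ 2 = sqnorm (x - y).
Proof. by rewrite sqr_sqrtr // sqnorm_ge0. Qed.

Lemma eucl_dist_ge0 (R : realType) (n : nat) (x y : 'rV[R]_n) :
  0 <= eucl_dist x y.
Proof. exact: sqrtr_ge0. Qed.

Lemma eucl_dist_le (R : realType) (n : nat) (x y : 'rV[R]_n) (c : R) : 0 <= c ->
  (eucl_dist x y <= c) = (sqnorm (x - y) <= c ^+ 2).
Proof. by move=> c0; rewrite -eucl_dist_sqr ler_sqr ?nnegrE ?eucl_dist_ge0. Qed.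

Lemma sqnormZ (R : realType) (n : nat) (a : R) (x : 'rV[R]_n) :
  sqnorm (a *: x) = a ^+ 2 * sqnorm x.
Proof. by rewrite mulr_sumr; apply: eq_bigr => i _; rewrite mxE exprMn. Qed.

Lemma sqnormN (R : realType) (n : nat) (x : 'rV[R]_n) : sqnorm (- x) = sqnorm x.
Proof. by apply: eq_bigr => i _; rewrite mxE sqrrN. Qed.

Lemma sqnormD_le (R : realType) (n : nat) (x y : 'rV[R]_n) :
  sqnorm (x + y) <= 2 * sqnorm x + 2 * sqnorm y.
Proof.
rewrite !mulr_sumr -big_split /=; apply: ler_sum => i _; rewrite mxE.
by have := sqr_ge0 (x ord0 i - y ord0 i); nra.
Qed.

Lemma sqnorm_row_mx (R : realType) (m n : nat) (x : 'rV[R]_m) (y : 'rV[R]_n) :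
  sqnorm (row_mx x y) = sqnorm x + sqnorm y.
Proof.
rewrite /sqnorm big_split_ord /=.
by congr (_ + _); apply: eq_bigr => i _; rewrite ?row_mxEl ?row_mxEr.
Qed.

Lemma nbhs_sqnorm (R : realType) (n : nat) (x : 'rV[R]_n) (e : R) : 0 < e ->
  nbhs x [set y | sqnorm (x - y) <= e].
Proof.
move=> e0; apply/nbhs_ballP.
(* Balls are taken in the sup norm, so [n] coordinates each contribute at most [e / n.+1]; the
   successor keeps the quotient meaningful for [n = 0]. *)
have c0 : 0 < Num.sqrt (e / n.+1%:R) by rewrite sqrtr_gt0 divr_gt0.
exists (Num.sqrt (e / n.+1%:R)) => //= y xy.
apply: (@le_trans _ _ (\sum_(i < n) (e / n.+1%:R))).
  apply: ler_sum => i _.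
  have /(_ ord0 i) : forall i j, ball (x i j) (Num.sqrt (e / n.+1%:R)) (y i j).
    by case: xy.
  rewrite /ball /= => /ltW; rewrite !mxE => h.
  have := lerXn2r 2 (normr_ge0 _) (ltW c0) h.
  by rewrite real_normK ?num_real // sqr_sqrtr // divr_ge0 // ltW.
rewrite sumr_const card_ord -[_ *+ n]mulr_natr -mulrA ler_piMr ?ltW //.
by rewrite mulrC ltr_pdivrMr // mul1r ltr_nat.
Qed.

(** * Kraft's inequality and infinite words avoiding a family of finite words *)

Section Kraft.
Local Open Scope ereal_scope.

(* Greedy choice: [m u], the mass of the words extending [u] relative to the
   cylinder of [u], is at most the average of [m] over the children of [u],
   so some child keeps it below 1; a word of [W] would have mass at least 1. *)
Lemma kraft_avoid (R : realType) (A : finType) (a0 : A) (W : nat -> seq (seq A)) :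
  \sum_(0 <= i <oo) (\sum_(w <- W i) #|A|%:R^-1 ^+ size w : R)%:E < 1 ->
  exists a : nat -> A, forall i n, mkseq a n \notin W i.
Proof.
move=> W1.
pose b : R := (#|A|%:R^-1)%R.
pose c (u w : seq A) : R := if prefix u w then (b ^+ (size w - size u))%R else 0%R.
pose m u : \bar R := \sum_(0 <= i <oo) (\sum_(w <- W i) c u w)%:E.
have b0 : (0 <= b)%R by rewrite invr_ge0.
have c0 u w : (0 <= c u w)%R by rewrite /c; case: ifP => // _; exact: exprn_ge0.
have s0 u i : 0 <= (\sum_(w <- W i) c u w)%:E by rewrite lee_fin sumr_ge0.
have m_in u i : u \in W i -> 1 <= m u.
  move=> ui; apply: (le_trans _ (nneseries_lim_ge i.+1 _)) => //=.
  rewrite big_nat_recr //= -[leLHS]add0e leeD ?sume_ge0 //.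
  rewrite lee_fin (big_rem u) //= {1}/c prefix_refl subnn expr0 lerDl.
  exact: sumr_ge0.
(* A word properly extending [u] extends exactly one child of [u], where its relative mass grows by
   the factor [#|A|]; if [w = u], or [w] does not extend [u], the left side is 0. *)
have step_c u w : (\sum_a c (rcons u a) w <= #|A|%:R * c u w)%R.
  have [/prefixP[[|a v] ->]|nuw] := boolP (prefix u w).
  - rewrite big1 ?mulr_ge0 // => a _; rewrite /c cats0.
    case: ifP => // /size_prefix; rewrite size_rcons ltnn//.
  - rewrite (bigD1 a) //= big1 ?addr0 => [|x xa].
      rewrite /c prefix_prefix -cat_rcons prefix_prefix !size_cat size_rcons.
      rewrite !addKn.
      rewrite addSn -addnS addKn exprS mulrA mulfV ?mul1r //.
      by rewrite pnatr_eq0 -lt0n; apply/card_gt0P; exists a.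
    rewrite /c; case: ifP => // /prefixP[v' /eqP].
    by rewrite cat_rcons eqseq_cat // eqxx /= eqseq_cons eq_sym (negPf xa).
  - rewrite big1 ?mulr_ge0 // => a _; rewrite /c; case: ifP => // /prefixP[v E].
    by case/negP: nuw; apply/prefixP; exists (a :: v); rewrite E cat_rcons.
(* The implication sits under the existential so that [choice] yields a total successor function. If
   every child had mass at least 1, the sum over children would give [#|A| <= #|A| * m u < #|A|]. *)
have step u : exists a, m u < 1 -> m (rcons u a) < 1.
  apply/not_existsP => H.
  have mu : m u < 1 by apply: contrapT => mu; apply: (H a0) => /mu.
  have ge1 a : 1 <= m (rcons u a).
    by rewrite leNgt; apply/negP => ma; apply: (H a).
  have : (#|A|%:R : R)%R%:E <= \sum_(a : A) m (rcons u a).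
    apply: (le_trans _ (lee_sum _ (fun a _ => ge1 a))).
    by rewrite sumEFin lee_fin sumr_const.
  rewrite leNgt => /negP; apply.
  rewrite -nneseries_sum //.
  apply: (@le_lt_trans _ _ ((#|A|%:R : R)%R%:E * m u)).
    rewrite -nneseriesZl //; apply: lee_nneseries => [i _ _|i _].
      exact: sume_ge0.
    rewrite sumEFin -EFinM lee_fin exchange_big mulr_sumr.
    by apply: ler_sum => w _; exact: step_c.
  by rewrite -[ltRHS]mule1 lte_pmul2l // lte_fin ltr0n; apply/card_gt0P; exists a0.
have [g gP] := choice step.
pose us := fix us n := if n is n'.+1 then rcons (us n') (g (us n')) else [::].
exists (fun n => g (us n)) => i n.
have -> : mkseq (fun n => g (us n)) n = us n.
  by elim: n => // n IH; rewrite mkseqS IH.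
apply/negP => /m_in; rewrite leNgt => /negP; apply.
elim: n => [|n IH] /=; last exact: gP.
apply: le_lt_trans W1; apply: lee_nneseries => // n _.
by rewrite lee_fin; apply: ler_sum => w _; rewrite /c prefix0s subn0.
Qed.

End Kraft.

(** * Words, addresses and the lower bound *)

Lemma foldr_half_mapB (R : realType) (p : 'I_3 -> 'rV[R]_2) (s : seq 'I_3) t t' :
  foldr (half_map p) t s - foldr (half_map p) t' s
    = 2^-1 ^+ size s *: (t - t').
Proof.
elim: s => [|i s IH] /=; first by rewrite expr0 scale1r.
by rewrite /half_map -scalerBr opprD addrACA subrr addr0 IH scalerA -exprS.
Qed.

(* The integer whose binary digits mark the occurrences of [j] in [s]. *)
Fixpoint digit_code (j : 'I_3) (s : seq 'I_3) : nat :=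
  if s is i :: s' then ((i == j) * 2 ^ size s' + digit_code j s')%N else 0%N.

Lemma digit_code_lt j s : (digit_code j s < 2 ^ size s)%N.
Proof.
elim: s => //= i s IH; rewrite expnS mul2n -addnn -addnS leq_add //.
by case: (i == j); rewrite ?mul1n ?mul0n.
Qed.

(** Each position of [s] carries exactly one letter, so the three binary numbers have disjoint
    digits that together fill all positions and add up to 2^k - 1. *)
Lemma sum_digit_code s : (\sum_(j < 3) digit_code j s).+1 = (2 ^ size s)%N.
Proof.
elim: s => [|i s IH] /=; first by rewrite big1.
rewrite big_split /= -addnS IH (bigD1 i) //= eqxx big1 ?addn0 ?mul1n.
  by rewrite addnn -mul2n -expnS.
by move=> j /negPf; rewrite eq_sym => ->.
Qed.

(** Binary expansions are unique, so the two codes locate all occurrences of two letters; the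
    remaining positions carry the third letter. *)
Lemma digit_code_inj s v : size s = size v ->
  (forall j : 'I_2, digit_code (lift ord0 j) s = digit_code (lift ord0 j) v) ->
  s = v.
Proof.
elim: s v => [|i s IH] [|i' v] //= [sv] E.
have {}E j : (i == lift ord0 j) = (i' == lift ord0 j) /\
    digit_code (lift ord0 j) s = digit_code (lift ord0 j) v.
  have := E j; have := digit_code_lt (lift ord0 j) s.
  have := digit_code_lt (lift ord0 j) v; rewrite sv.
  by case: (i == _); case: (i' == _); rewrite ?mul1n ?mul0n ?add0n;
    move=> lv ls eq; split=> //; lia.
rewrite (IH v) // => [|j]; last by case: (E j).
congr (_ :: _).
case: (unliftP ord0 i) => [j ij|i0].
  by case: (E j) => + _; rewrite -ij eqxx => /esym/eqP.
case: (unliftP ord0 i') => [j ij|->//].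
by case: (E j) => + _; rewrite -ij eqxx => /eqP.
Qed.

(** Multiplying by 2^k clears the denominators: up to the translation by [t], the image is a lattice
    point whose integer coordinates are the digit codes. *)
Lemma foldr_half_mapE (R : realType) (p : 'I_3 -> 'rV[R]_2) (s : seq 'I_3) t :
  2 ^+ size s *: foldr (half_map p) t s
    = t + \sum_(j < 3) (digit_code j s)%:R *: p j.
Proof.
elim: s => [|i s IH] /=.
  by rewrite scale1r big1 ?addr0 // => j _; rewrite scale0r.
rewrite /half_map scalerA exprSr mulfK // scalerDr IH -addrA; congr (_ + _).
under [in RHS]eq_bigr do rewrite natrD scalerDl.
rewrite big_split /= addrC; congr (_ + _).
rewrite (bigD1 i) //= eqxx mul1n natrX big1 ?addr0 // => j /negPf.
by rewrite eq_sym => ->; rewrite mul0n scale0r.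
Qed.

(** Polarization: the cross term is expressed by [sqnorm (u - v)], so that in an equilateral
    triangle all three norms equal the squared side. *)
Lemma sqnorm_comb2 (R : realType) (n : nat) (x y : R) (u v : 'rV[R]_n) :
  sqnorm (x *: u + y *: v) = (x ^+ 2 + x * y) * sqnorm u
    + (y ^+ 2 + x * y) * sqnorm v - x * y * sqnorm (u - v).
Proof.
rewrite !mulr_sumr -big_split /= -sumrB; apply: eq_bigr => i _.
by rewrite !mxE; ring.
Qed.

(* In a triangular lattice of step l, |x e1 + y e2|^2 = l^2 (x^2 + x y + y^2),
   which is at least l^2 (x^2 + y^2) / 2. *)
Lemma digit_code_dist (R : realType) (p : 'I_3 -> 'rV[R]_2) : equilateral p ->
  exists2 c : R, 0 < c & forall s v t (j : 'I_2), size s = size v ->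
    c * ((digit_code (lift ord0 j) s)%:R - (digit_code (lift ord0 j) v)%:R) ^+ 2
    <= 4 ^+ size s *
       sqnorm (foldr (half_map p) t s - foldr (half_map p) t v).
Proof.
move=> [l l0 lP]; exists (l ^+ 2 / 2); first by rewrite divr_gt0 ?exprn_gt0.
move=> s v t j sv.
have D i k : i != k -> sqnorm (p i - p k) = l ^+ 2.
  by move=> ik; rewrite -eucl_dist_sqr lP.
pose d i : R := (digit_code i s)%:R - (digit_code i v)%:R.
pose x := d (lift ord0 ord0); pose y := d (lift ord0 ord_max).
(* Words of equal length have codes with equal sums. As the differences add up to 0, [p ord0] may be
   subtracted from each vertex, which leaves two edge vectors. *)
have d0 : \sum_(i < 3) d i = 0.
  rewrite sumrB -!natr_sum; apply/eqP; rewrite subr_eq0 eqr_nat.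
  by rewrite -eqSS !sum_digit_code sv.
rewrite (_ : 4 = 2 ^+ 2); last by rewrite -natrX.
rewrite -exprM mulnC exprM -sqnormZ scalerBr.
rewrite {2}sv !foldr_half_mapE opprD addrACA subrr add0r -sumrB.
have -> : \sum_(i < 3) ((digit_code i s)%:R *: p i - (digit_code i v)%:R *: p i)
  = x *: (p (lift ord0 ord0) - p ord0)
    + y *: (p (lift ord0 ord_max) - p ord0).
  under eq_bigr do rewrite -scalerBl.
  have -> : \sum_(i < 3) d i *: p i = \sum_(i < 3) d i *: (p i - p ord0).
    under [RHS]eq_bigr do rewrite scalerBr.
    by rewrite sumrB -scaler_suml d0 scale0r subr0.
  rewrite !big_ord_recl big_ord0 subrr scaler0 add0r addr0.
  by congr (_ + d _ *: (p _ - _)); apply: val_inj.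
rewrite sqnorm_comb2 opprB addrA subrK !D //.
rewrite -/(d (lift ord0 j)).
have {d0} : d (lift ord0 j) = x \/ d (lift ord0 j) = y.
  case: j => -[|[|//]] h; [left|right]; congr (d (lift _ _)); exact: val_inj.
have := ltW (exprn_gt0 2 l0); set L := l ^+ 2.
move: (d (lift ord0 j)) x y => z x y L0.
(* These rest on x^2 + x y + y^2 = ((x + y)^2 + x^2 + y^2) / 2. *)
have h1 : 0 <= L * (x + y) ^+ 2 by rewrite mulr_ge0 ?sqr_ge0.
have h2 : 0 <= L * x ^+ 2 by rewrite mulr_ge0 ?sqr_ge0.
have h3 : 0 <= L * y ^+ 2 by rewrite mulr_ge0 ?sqr_ge0.
by move=> [] -> /=; nra.
Qed.

(** By [digit_code_dist] the two codes of a word in [S] stay within [Q] of those of a fixed [w0] in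
    [S], where Q^2 >= C / c. This leaves at most 2Q + 1 values per code, whatever [k] and [t]
    are. *)
Lemma card_near_words (R : realType) (p : 'I_3 -> 'rV[R]_2) (C : R) :
  equilateral p -> exists M : nat, forall k t (S : {set k.-tuple 'I_3}),
    (forall s v, s \in S -> v \in S ->
       4 ^+ k * sqnorm (foldr (half_map p) t s - foldr (half_map p) t v) <= C) ->
    (#|S| <= M)%N.
Proof.
move=> /digit_code_dist[c c0 cP]; pose Q := (Num.trunc (C / c)).+1.
exists (#|{ffun 'I_2 -> 'I_(Q + Q).+1}|) => k t S near.
have [->|[w0 w0S]] := set_0Vmem S; first by rewrite cards0.
have close w (j : 'I_2) : w \in S ->
    (digit_code (lift ord0 j) w <= Q + digit_code (lift ord0 j) w0)%N /\
    (digit_code (lift ord0 j) w0 <= Q + digit_code (lift ord0 j) w)%N.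
  move=> wS; have := cP w w0 t j; rewrite !size_tuple => /(_ erefl).
  move=> /le_trans /(_ (near _ _ wS w0S)).
  rewrite mulrC -ler_pdivlMr // => d.
  have : C / c <= Q%:R ^+ 2.
    have := truncnS_gt (C / c); rewrite -/Q => /ltW /le_trans; apply.
    by rewrite -natrX ler_nat expnS leq_pmulr.
  move=> /(le_trans d); rewrite -real_normK ?num_real // ler_sqr ?nnegrE //.
  rewrite ler_norml lerBlDr -natrD ler_nat lerNl opprB lerBlDr -natrD ler_nat.
  by case/andP.
(* Adding [Q] first makes the subtraction of natural numbers exact, hence [F] injective on [S]. *)
pose F (w : k.-tuple 'I_3) : {ffun 'I_2 -> 'I_(Q + Q).+1} :=
  [ffun j => inord (Q + digit_code (lift ord0 j) w
                      - digit_code (lift ord0 j) w0)%N].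
rewrite -(@card_in_imset _ _ F) ?max_card // => w w' wS wS' /ffunP E.
have lt a c' : (a <= Q + c' -> Q + a - c' < (Q + Q).+1)%N by lia.
have inj a b c' : (c' <= Q + a)%N -> (c' <= Q + b)%N ->
  (Q + a - c' = Q + b - c')%N -> a = b by lia.
apply/val_inj/(@digit_code_inj (tval w) (tval w')) => [|j]; first by rewrite !size_tuple.
have [a1 a2] := close w j wS; have [a3 a4] := close w' j wS'.
have := congr1 (@nat_of_ord _) (E j); rewrite !ffunE !inordK; [exact: inj|exact: lt..].
Qed.

Lemma card_near_word_pairs (R : realType) (p q : 'I_3 -> 'rV[R]_2) (C : R) :
  equilateral p -> equilateral q ->
  exists M : nat, forall k t t' (S : {set k.-tuple ('I_3 * 'I_3)}),
    (forall s v, s \in S -> v \in S ->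
       4 ^+ k * sqnorm (foldr (half_map p) t (unzip1 s)
                        - foldr (half_map p) t (unzip1 v)) <= C /\
       4 ^+ k * sqnorm (foldr (half_map q) t' (unzip2 s)
                        - foldr (half_map q) t' (unzip2 v)) <= C) ->
    (#|S| <= M)%N.
Proof.
move=> /(card_near_words C)[M1 M1P] /(card_near_words C)[M2 M2P].
exists (M1 * M2)%N => k t t' S near.
pose F (w : k.-tuple ('I_3 * 'I_3)) :=
  ([tuple of map fst w], [tuple of map snd w]).
have injF : injective F.
  move=> w w' [e1 e2]; apply: val_inj => /=.
  by rewrite -(zip_unzip w) -(zip_unzip w') /unzip1 /unzip2 e1 e2.
rewrite -(card_imset _ injF).
pose S1 := (fun w : k.-tuple ('I_3 * 'I_3) => [tuple of map fst w]) @: S.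
pose S2 := (fun w : k.-tuple ('I_3 * 'I_3) => [tuple of map snd w]) @: S.
apply: (@leq_trans #|finset.setX S1 S2|).
  apply: subset_leq_card; apply/fintype.subsetP => _ /imsetP[w wS ->].
  by rewrite inE /=; apply/andP; split; apply/imsetP; exists w.
rewrite cardsX leq_mul //.
  apply: (M1P k t) => _ _ /imsetP[s sS ->] /imsetP[v vS ->].
  by have [] := near _ _ sS vS.
apply: (M2P k t') => _ _ /imsetP[s sS ->] /imsetP[v vS ->].
by have [] := near _ _ sS vS.
Qed.

Lemma gasket_nonempty (R : realType) (p : 'I_3 -> 'rV[R]_2) SG :
  is_gasket p SG -> SG !=set0.
Proof. by case. Qed.

Lemma gasket_foldr (R : realType) (p : 'I_3 -> 'rV[R]_2) SG s t :
  is_gasket p SG -> SG t -> SG (foldr (half_map p) t s).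
Proof.
move=> [_ _ _ inv _] t_SG; elim: s => //= i s IH.
by rewrite inv; exists i => //; exists (foldr (half_map p) t s).
Qed.

Lemma gasket_word (R : realType) (p : 'I_3 -> 'rV[R]_2) SG n t :
  is_gasket p SG -> SG t ->
  exists (w : word n) t', SG t' /\ t = foldr (half_map p) t' w.
Proof.
move=> [_ _ _ inv _]; elim: n t => [|n IH] t tSG; first by exists [tuple], t.
move: tSG; rewrite {1}inv => -[i _ [t1 /IH[w [t' [t'SG ->]]] <-]].
by exists [tuple of i :: w], t'.
Qed.

Lemma half_exprn_sqr (R : realType) k : (2^-1 ^+ k) ^+ 2 = (4 ^+ k)^-1 :> R.
Proof. by rewrite -exprM mulnC exprM expr2 -invfM -natrM exprVn. Qed.

Lemma gasket_address (R : realType) (p : 'I_3 -> 'rV[R]_2) SG t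
    (a : nat -> 'I_3) :
  is_gasket p SG -> (forall x y, SG x -> SG y -> sqnorm (x - y) <= 1) -> SG t ->
  exists2 x, SG x &
    forall k, 4 ^+ k * sqnorm (x - foldr (half_map p) t (mkseq a k)) <= 4.
Proof.
move=> gSG diam tSG; have cSG : compact SG by case: gSG.
pose u n := foldr (half_map p) t (mkseq a n).
have uSG n : SG (u n) by exact: gasket_foldr.
have [|x [xSG clx]] := cSG (u @ \oo) _.
  by exists 0%N => // n _; exact: uSG.
exists x => // k.
have e0 : 0 < (4 ^+ k)^-1 :> R by rewrite invr_gt0 exprn_gt0.
have Fk : (u @ \oo) (u @` [set n | (k <= n)%N]).
  by exists k => // n /= kn; exists n.
have [_ [[n /= kn <-] /= xn]] := clx _ _ Fk (nbhs_sqnorm x e0).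
(* For n >= k the two words share their outer [k] letters, which contract a difference of two gasket
   points by 2^-k. *)
have nk : sqnorm (u n - u k) <= (4 ^+ k)^-1.
  rewrite /u /mkseq -(subnKC kn) iotaD map_cat foldr_cat foldr_half_mapB.
  rewrite size_map size_iota sqnormZ.
  rewrite half_exprn_sqr ler_piMr ?(ltW e0) //.
  by apply: diam => //; exact: gasket_foldr.
rewrite mulrC -ler_pdivlMr ?exprn_gt0 // -(subrKA (u n)).
by apply: (le_trans (sqnormD_le _ _)); lra.
Qed.

(** The exponent is log 9 / log 2, the similarity dimension of nine copies of ratio 1/2. *)
Lemma half_powR (R : realType) k :
  (2^-1 ^+ k) `^ (2 * (ln 3 / ln 2)) = 9^-1 ^+ k :> R.
Proof.
have ln2 : 0 < ln (2 : R) by rewrite ln_gt0 // ltr1n.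
have h : (2^-1 : R) `^ (2 * (ln 3 / ln 2)) = 9^-1.
  rewrite /powR gt_eqF // lnV ?posrE // (_ : _ * _ = - (ln 3 + ln 3)).
    by rewrite expRN expRD lnK ?posrE // -natrM.
  by field; rewrite gt_eqF.
rewrite -powR_mulrn // -powRrM mulrC powRrM h powR_mulrn //.
Qed.

Lemma ediam_ge (R : realType) n (U : set 'rV[R]_n) x y : U x -> U y ->
  ((eucl_dist x y)%:E <= ediam U)%E.
Proof. by move=> Ux Uy; apply: ereal_sup_ubound; exists (x, y). Qed.

Lemma ediam_ge0 (R : realType) n (U : set 'rV[R]_n) :
  U !=set0 -> (0 <= ediam U)%E.
Proof.
by move=> [x Ux]; apply: le_trans (ediam_ge Ux Ux); rewrite lee_fin eucl_dist_ge0.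
Qed.

(** For a diameter x > 0 take 2^-(k+1) < x <= 2^-k: since x <= 1 and d <= D = log 9 / log 2, x^d >=
    x^D >= 9^-(k+1). For diameter 0 any large [k] serves, and [e] pays for 9^-k. *)
Lemma dyadic_scale (R : realType) n (U : set 'rV[R]_n) (d e : R) :
  d <= 2 * (ln 3 / ln 2) -> 0 < e -> (ediam U <= 1)%E ->
  exists k, U !=set0 -> (ediam U <= (2^-1 ^+ k)%:E)%E /\
    ((9^-1 ^+ k)%:E <= 9%:E * ediam U `^ d + e%:E)%E.
Proof.
move=> dD e0; have [U0|] := pselect (U !=set0); last by exists 0%N.
have := ediam_ge0 U0; case: (ediam U) => // x.
rewrite !lee_fin => x_ge0 x1; move: x_ge0; rewrite le_eqVlt => /predU1P[<-|x0].
  have [||k /andP[k1 _]] := @geometric_bracket R 9^-1 (Num.min e 1).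
  - by rewrite invr_gt0 ltr0n invf_lt1 // ltr1n.
  - by rewrite lt_min e0 ltr01 ge_min lexx orbT.
  exists k.+1 => _; rewrite poweR_EFin -EFinM -EFinD !lee_fin exprn_ge0 //.
  split=> //; have := powR_ge0 0 d; move: k1; rewrite lt_min => /andP[].
  by lra.
have [||k /andP[k1 k2]] := @geometric_bracket R 2^-1 x.
- by rewrite invr_gt0 ltr0n invf_lt1 // ltr1n.
- by rewrite x0.
exists k => _; rewrite poweR_EFin -EFinM -EFinD !lee_fin; split=> //.
have : 9^-1 ^+ k.+1 <= x `^ d.
  rewrite -half_powR; apply: (@le_trans _ _ (x `^ (2 * (ln 3 / ln 2)))).
    apply: ge0_ler_powR; rewrite ?nnegrE ?exprn_ge0 ?(ltW x0) ?(ltW k1) //.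
    by rewrite mulr_ge0 // divr_ge0 // ln_ge0 // ler1n.
  by apply: ger_powR => //; rewrite x0.
rewrite exprS; lra.
Qed.

(** Since [P1] and [P2] do not increase distances, a small set covering part of [A] is charged with
    few pairs of words; being jointly onto the product, they lift the point of an avoided address
    back to [A]. *)
Lemma hausdorff_dim_ge (R : realType) (p q : 'I_3 -> 'rV[R]_2) (SG1 SG2 : set 'rV[R]_2)
    n (A : set 'rV[R]_n) (P1 P2 : 'rV[R]_n -> 'rV[R]_2) :
  equilateral p -> equilateral q -> is_gasket p SG1 -> is_gasket q SG2 ->
  (forall x y, SG1 x -> SG1 y -> sqnorm (x - y) <= 1) ->
  (forall x y, SG2 x -> SG2 y -> sqnorm (x - y) <= 1) ->
  (forall x y, sqnorm (P1 x - P1 y) <= sqnorm (x - y)) ->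
  (forall x y, sqnorm (P2 x - P2 y) <= sqnorm (x - y)) ->
  (forall x1 x2, SG1 x1 -> SG2 x2 -> exists2 y, A y & P1 y = x1 /\ P2 y = x2) ->
  ((2 * (ln 3 / ln 2))%:E <= hausdorff_dim A)%E.
Proof.
move=> hp hq g1 g2 diam1 diam2 P1L P2L surj.
apply: le_ereal_inf_tmp => _ [d [d0 H0] <-]; rewrite lee_fin leNgt.
apply/negP => /ltW dD.
have [t1 t1SG] := gasket_nonempty g1; have [t2 t2SG] := gasket_nonempty g2.
(* 28 = 2 * 4 + 2 * (2 * 1 + 2 * 4), from two uses of the squared triangle inequality in [tri]. *)
have [M MP] := card_near_word_pairs 28 hp hq.
(* The total mass of the words will be at most 9 M e + M e = M / (2 (M + 1)) < 1. *)
pose e : R := (20 * M.+1%:R)^-1.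
have e0 : 0 < e by rewrite invr_gt0 mulr_gt0.
have : (hausdorff_content d 1 A < e%:E)%E.
  apply: (@le_lt_trans _ _ 0%E); last by rewrite lte_fin.
  by rewrite -H0; apply: ereal_sup_ubound; exists 1 => //=.
move=> /ereal_inf_lt[_ [U [AU U1] <-] Ue].
have ei i : 0 < e / (2 ^ i.+1)%:R by rewrite divr_gt0 // ltr0n expn_gt0.
have /choice[k kP] i := dyadic_scale dD (ei i) (U1 i).
(* The words charged to [U i]: those of length [k i] whose vertices lie within 2 * 2^-(k i) of both
   projections of some point of [U i]. *)
pose near i (w : seq ('I_3 * 'I_3)) := exists y, [/\ U i y,
  4 ^+ k i * sqnorm (P1 y - foldr (half_map p) t1 (unzip1 w)) <= 4 &
  4 ^+ k i * sqnorm (P2 y - foldr (half_map q) t2 (unzip2 w)) <= 4].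
pose S i : {set (k i).-tuple ('I_3 * 'I_3)} := 
  [set w : (k i).-tuple ('I_3 * 'I_3) | `[< near i w >]]%SET.
pose W i := [seq tval w | w in S i].
have S_le i : (#|S i| <= M)%N.
  apply: (MP _ t1 t2) => s v; rewrite !inE => -[y [Uy y1 y2]] [y' [Uy' y1' y2']].
  have yy' : sqnorm (y - y') <= (4 ^+ k i)^-1.
    have [] := kP i; first by exists y.
    move=> /(le_trans (ediam_ge Uy Uy')) + _; rewrite lee_fin.
    by rewrite eucl_dist_le ?exprn_ge0 // half_exprn_sqr.
  have tri (z z' a a' : 'rV[R]_2) : 4 ^+ k i * sqnorm (z - a) <= 4 ->
      4 ^+ k i * sqnorm (z' - a') <= 4 -> sqnorm (z - z') <= sqnorm (y - y') ->
      4 ^+ k i * sqnorm (a - a') <= 28.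
    have c0 : 0 < 4 ^+ k i :> R by rewrite exprn_gt0.
    rewrite !(mulrC (4 ^+ k i)) -!ler_pdivlMr // => za za' zz'.
    rewrite -(subrKA z) -(subrKA z' z).
    apply: (le_trans (sqnormD_le _ _)).
    rewrite -[a - z]opprB sqnormN.
    have := sqnormD_le (z - z') (z' - a'); lra.
  by split; [apply: (tri (P1 y) (P1 y'))|apply: (tri (P2 y) (P2 y'))].
have Wsum : (\sum_(0 <= i <oo)
    (\sum_(w <- W i) #|{: 'I_3 * 'I_3}|%:R^-1 ^+ size w : R)%:E < 1)%E.
  pose v i : \bar R := (if U i != set0 then (M%:R * 9)%:E * ediam (U i) `^ d
                        else 0)%E.
  have v0 i : (0 <= v i)%E.
    rewrite /v; case: ifP => // _; apply: mule_ge0; last exact: poweR_ge0.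
    by rewrite lee_fin mulr_ge0.
  have Me0 : 0 <= M%:R * e by rewrite mulr_ge0 // ltW.
  apply: (@le_lt_trans _ _
    (\sum_(0 <= i <oo) (v i + (M%:R * e / (2 ^ i.+1)%:R)%:E))%E).
    apply: lee_nneseries => [i _ _|i _].
      rewrite lee_fin; apply: sumr_ge0 => w _; apply: exprn_ge0.
      by rewrite invr_ge0.
    have -> : \sum_(w <- W i) #|{: 'I_3 * 'I_3}|%:R^-1 ^+ size w
        = #|S i|%:R * 9^-1 ^+ k i :> R.
      rewrite big_map big_enum /=.
      under eq_bigr do rewrite size_tuple card_prod card_ord.
      by rewrite sumr_const mulr_natl.
    rewrite /v; case: ifPn => [/set0P U0|/negPn/eqP U0].
      have [_ h] := kP i U0.
      apply: (@le_trans _ _ (M%:R%:E * (9^-1 ^+ k i)%:E)%E).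
        by rewrite -EFinM lee_fin ler_wpM2r ?exprn_ge0 // ler_nat.
      apply: (le_trans (lee_wpmul2l _ h)); first by rewrite lee_fin.
      rewrite ge0_muleDr ?lee_fin ?(ltW (ei i)) //; last first.
        by apply: mule_ge0; [rewrite lee_fin|exact: poweR_ge0].
      by rewrite muleA -!EFinM mulrA.
    rewrite add0e lee_fin (_ : #|S i| = 0%N) ?mul0r.
      by rewrite divr_ge0.
    apply/eqP; rewrite cards_eq0; apply/eqP/setP => w; rewrite !inE.
    by apply/asboolPn => -[y []]; rewrite U0.
  apply: (le_lt_trans (epsilon_trick xpredT v0 Me0)).
  have -> : (\sum_(0 <= i <oo) v i = (M%:R * 9)%:E *
      \sum_(0 <= i <oo | U i != set0) ediam (U i) `^ d)%E.
    rewrite -nneseriesZl => [|i _]; last exact: poweR_ge0.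
    by rewrite [RHS]eseries_mkcond.
  apply: (@le_lt_trans _ _ ((M%:R * 9)%:E * e%:E + (M%:R * e)%:E)%E).
    by rewrite leeD2r // lee_wpmul2l ?lee_fin ?mulr_ge0 // ltW.
  rewrite -EFinM -EFinD lte_fin /e.
  have M1 : (0 : R) < M.+1%:R by rewrite ltr0n.
  rewrite -mulrDl -(ltr_pM2r (_ : 0 < 20 * M.+1%:R)) ?mulr_gt0 //.
  rewrite -mulrA mulVf ?gt_eqF ?mulr_gt0 // -natr1.
  by have := ler0n R M; lra.
(* A point of [A] over the avoided address lies in some [U i], which makes the prefix of length
   [k i] one of the words in [W i], a contradiction. *)
have [a aP] := kraft_avoid (ord0, ord0) Wsum.
have [x1 x1SG x1P] := gasket_address (fun n => (a n).1) g1 diam1 t1SG.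
have [x2 x2SG x2P] := gasket_address (fun n => (a n).2) g2 diam2 t2SG.
have [y Ay [y1 y2]] := surj _ _ x1SG x2SG.
have [i _ Uiy] := AU y Ay.
have := aP i (k i); rewrite /W => /negP; apply.
apply/fintype.imageP; exists [tuple of mkseq a (k i)] => //; rewrite inE.
apply/asboolP; exists y; rewrite y1 y2 /unzip1 /unzip2 /= -!map_comp.
by split.
Qed.

(** * Hausdorff dimension and box dimension *)

Lemma poweR_le_EFin (R : realType) (x : \bar R) (y d : R) :
  0 <= d -> 0 <= y -> (0 <= x)%E -> (x <= y%:E)%E ->
  (x `^ d <= (y `^ d)%:E)%E.
Proof.
case: x => // x d0 y0; rewrite poweR_EFin !lee_fin => x0 xy.
exact: ge0_ler_powR.
Qed.

Lemma ediam_set0 (R : realType) n : ediam (set0 : set 'rV[R]_n) = -oo%E.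
Proof. by rewrite /ediam setX0 image_set0 ereal_sup0. Qed.

Lemma hausdorff_content_cover (R : realType) n (A : set 'rV[R]_n) (d delta : R)
    k (U : 'I_k -> set 'rV[R]_n) :
  0 <= d -> 0 <= delta ->
  A `<=` \bigcup_i U i -> (forall i, (ediam (U i) <= delta%:E)%E) ->
  (hausdorff_content d delta A <= (k%:R * delta `^ d)%:E)%E.
Proof.
move=> d0 delta0 AU Ud.
(* The finite cover is padded with empty sets, which the sum in the content skips. *)
pose V i := if insub i is Some j then U j else set0.
have Vd i : (ediam (V i) <= delta%:E)%E.
  by rewrite /V; case: insubP => [j _ _|_]; [exact: Ud|rewrite ediam_set0 leNye].
apply: (@le_trans _ _ (\sum_(0 <= i <oo | V i != set0) ediam (V i) `^ d)%E).
  apply: ereal_inf_lbound; exists V => //; split => // x /AU[j _ Ujx].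
  by exists (j : nat) => //; rewrite /V valK.
rewrite (nneseries_split_cond 0 k) => [|i _]; last exact: poweR_ge0.
rewrite add0n eseries0 ?adde0 => [|i ki]; last first.
  by rewrite /V insubF ?eqxx // ltnNge ki.
apply: (@le_trans _ _ (\sum_(0 <= i < k | V i != set0) (delta `^ d)%:E)%E).
  apply: lee_sum => i /set0P[x Vx]; apply: poweR_le_EFin => //.
  by apply: le_trans (ediam_ge Vx Vx); rewrite lee_fin eucl_dist_ge0.
rewrite sumEFin lee_fin.
apply: (@le_trans _ _ (\sum_(0 <= i < k) delta `^ d)).
  by rewrite [leLHS]big_mkcond; apply: ler_sum => i _; case: ifP; rewrite ?powR_ge0.
by rewrite sumr_const_nat subn0 mulr_natl.
Qed.

Lemma hausdorff_content_anti (R : realType) n (A : set 'rV[R]_n) (d x y : R) :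
  x <= y -> (hausdorff_content d y A <= hausdorff_content d x A)%E.
Proof.
move=> xy; apply: ereal_inf_le_tmp => _ [U [AU Ux] <-]; exists U => //; split=> //.
by move=> i; apply: le_trans (Ux i) _; rewrite lee_fin.
Qed.

Lemma hausdorff_content_ge0 (R : realType) n (A : set 'rV[R]_n) (d x : R) :
  (0 <= hausdorff_content d x A)%E.
Proof.
apply: le_ereal_inf_tmp => _ [U _ <-]; apply: nneseries_ge0 => i _ _.
exact: poweR_ge0.
Qed.

Lemma covering_number_ge1 (R : realType) n (A : set 'rV[R]_n) (x : R) :
  A !=set0 -> (1 <= covering_number A x)%E.
Proof.
move=> [a Aa]; apply: le_ereal_inf_tmp => _ [k [U [AU _]] <-].
by case: k U AU => [U /(_ a Aa)[[]]//|k _ _]; rewrite lee_fin ler1n.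
Qed.

Lemma lne_ratio_le (R : realType) (c : \bar R) (x r : R) : 0 < x < 1 ->
  (1 <= c)%E -> (lne c * (- ln x)^-1%:E <= r%:E)%E -> (c <= (x `^ (- r))%:E)%E.
Proof.
move=> /andP[x0 x1]; have lx : 0 < - ln x by rewrite oppr_gt0 ln_lt0 // x0.
case: c => [c| |] //; last first.
  by move=> _; rewrite /lne gt0_mulye // lte_fin invr_gt0.
rewrite !lee_fin => c1; have c0 : 0 < c by exact: lt_le_trans c1.
rewrite lne_EFin // -EFinM lee_fin ler_pdivrMr // => h.
by rewrite -ler_ln ?posrE ?powR_gt0 // ln_powR // mulNr -mulrN.
Qed.

Lemma powR_near0 (R : realType) (e y : R) : 0 < e -> 0 < y ->
  \forall x \near (0 : R)^'+, x `^ e <= y.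
Proof.
move=> e0 y0; near=> x.
have <- : (y `^ e^-1) `^ e = y.
  by rewrite -powRrM mulVf ?gt_eqF // powRr1 // ltW.
have x0 : 0 < x by near: x; exact: nbhs_right_gt.
apply: ge0_ler_powR; rewrite ?nnegrE ?powR_ge0 ?(ltW e0) ?(ltW x0) //.
by near: x; apply: nbhs_right_le; exact: powR_gt0.
Unshelve. all: by end_near. Qed.

(** If the logarithmic ratios near 0 are at most [r], then x^-r bounds the covering number, so the
    content of exponent r + e is at most 2 x^-r x^(r+e) = 2 x^e, which tends to 0. *)
Lemma hausdorff_dim_le_upper_box_dim (R : realType) n (A : set 'rV[R]_n) :
  A !=set0 -> (hausdorff_dim A <= upper_box_dim A)%E.
Proof.
move=> A0; apply: le_ereal_inf_tmp => _ [V V0 <-].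
set s := ereal_sup _.
have sV x : V x -> (lne (covering_number A x) * (- ln x)^-1%:E <= s)%E.
  by move=> Vx; apply: ereal_sup_ubound; exists x.
(* This makes [r + e] an admissible exponent in [hausdorff_dim]; a nonempty set has covering number
   at least 1, so its ratio at a scale below 1 is nonnegative. *)
have s0 : (0 <= s)%E.
  have /filter_ex[x [Vx x0 x1]] :
      \forall x \near (0 : R)^'+, [/\ V x, 0 < x & x < 1].
    by near=> x; split; near: x; [exact: V0|exact: nbhs_right_gt|exact: nbhs_right_lt].
  apply: le_trans (sV x Vx); apply: mule_ge0; last first.
    by rewrite lee_fin invr_ge0 oppr_ge0 ln_le0 // ltW.
  by rewrite lne_ge0 covering_number_ge1.
case: s s0 sV => [r||]; [|by move=> _ _; exact: leey|by []].
rewrite lee_fin => r0 rV; apply/lee_addgt0Pr => e e0.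
rewrite -EFinD; apply: ereal_inf_lbound; exists (r + e) => //=.
have d0 : 0 <= r + e by rewrite addr_ge0 // ltW.
split=> //; apply/eqP; rewrite eq_le; apply/andP; split; last first.
  apply: le_trans (hausdorff_content_ge0 A (r + e) 1) _.
  by apply: ereal_sup_ubound; exists 1 => //=.
apply: ge_ereal_sup => _ [t /= t0 <-].
apply/lee_addgt0Pr => y y0; rewrite add0e.
have y2 : 0 < y / 2 by rewrite divr_gt0.
have /filter_ex[x [Vx [x0 x1] xt xe]] : \forall x \near (0 : R)^'+,
    [/\ V x, 0 < x /\ x < 1, x <= t & x `^ e <= y / 2].
  near=> x; split; near: x.
  - exact: V0.
  - by near=> x; split; near: x; [exact: nbhs_right_gt|exact: nbhs_right_lt].
  - exact: nbhs_right_le.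
  - exact: powR_near0.
apply: le_trans (hausdorff_content_anti A (r + e) xt) _.
have := lne_ratio_le _ (covering_number_ge1 x A0) (rV x Vx).
rewrite x0 x1 => /(_ isT) Nx.
(* The factor 2 makes the inequality strict, so that an actual finite cover can be drawn from the
   infimum. *)
have : (covering_number A x < (2 * x `^ (- r))%:E)%E.
  apply: (le_lt_trans Nx); rewrite lte_fin.
  by have := powR_gt0 (- r) x0; lra.
move=> /ereal_inf_lt[_ [k [U [AU Ux]] <-]]; rewrite lte_fin => kx.
apply: (le_trans (hausdorff_content_cover d0 (ltW x0) AU Ux)).
rewrite lee_fin; apply: (@le_trans _ _ (2 * x `^ (- r) * x `^ (r + e))).
  by rewrite ler_wpM2r ?powR_ge0 // ltW.
rewrite -mulrA -powRD; last by rewrite (gt_eqF x0) implybT.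
by rewrite addKr; lra.
Unshelve. all: by end_near. Qed.

(** The constant is absorbed by an arbitrarily small exponent: C x^-E <= x^-(E+e) once x^e <= 1 /
    C. *)
Lemma upper_box_dim_le (R : realType) n (A : set 'rV[R]_n) (C E : R) : 0 < C ->
  (forall x, 0 < x < 1 -> (covering_number A x <= (C * x `^ (- E))%:E)%E) ->
  (upper_box_dim A <= E%:E)%E.
Proof.
move=> C0 H; apply/lee_addgt0Pr => e e0.
apply: ge_ereal_inf.
exists (ereal_sup [set (lne (covering_number A x) * (- ln x)^-1%:E)%E
  | x in [set x : R | [/\ 0 < x, x < 1 & x `^ e <= C^-1]]]); last first.
  apply: ge_ereal_sup => _ [x /= [x0 x1 xe] <-].
  have lx : 0 < - ln x by rewrite oppr_gt0 ln_lt0 // x0.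
  have N0 : (0 <= covering_number A x)%E.
    by apply: le_ereal_inf_tmp => _ [k _ <-]; rewrite lee_fin.
  have Nx : (covering_number A x <= (x `^ (- (E + e)))%:E)%E.
    apply: (le_trans (H x _)); first by rewrite x0.
    rewrite lee_fin opprD powRD; last by rewrite (gt_eqF x0) implybT.
    rewrite mulrC ler_wpM2l ?powR_ge0 // powRN -[C]invrK.
    by rewrite lef_pV2 // posrE ?invr_gt0 ?powR_gt0.
  rewrite -EFinD -[(E + e)%:E]mule1.
  apply: (@le_trans _ _ (lne (x `^ (- (E + e)))%:E * (- ln x)^-1%:E)%E).
    apply: lee_wpmul2r; first by rewrite lee_fin invr_ge0 ltW.
    by rewrite lee_lne // in_itv /= ?N0 ?leey // lee_fin powR_ge0.
  rewrite lne_EFin ?powR_gt0 // ln_powR // mulNr -mulrN -EFinM mulfK ?gt_eqF //.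
  by rewrite mule1.
exists [set x : R | [/\ 0 < x, x < 1 & x `^ e <= C^-1]] => //.
change (\forall x \near (0 : R)^'+, [/\ 0 < x, x < 1 & x `^ e <= C^-1]).
near=> x; split; near: x.
- exact: nbhs_right_gt.
- exact: nbhs_right_lt.
- by apply: powR_near0; rewrite ?invr_gt0.
Unshelve. all: by end_near. Qed.

(** * Oscillation over cells and the upper bound *)

(** A cell of level n is addressed by n blocks of [N] letters per factor, outermost block first,
    matching one application of the self-referential equation per block. *)
Definition cell_map (R : realType) (p q : 'I_3 -> 'rV[R]_2) N
    (c : seq (word N * word N)) (x : 'rV[R]_2 * 'rV[R]_2) :=
  foldr (fun we x => (word_map p we.1 x.1, word_map q we.2 x.2)) x c.

Lemma pdist_sqr (R : realType) (x y : 'rV[R]_2 * 'rV[R]_2) :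
  pdist x y ^+ 2 = sqnorm (x.1 - y.1) + sqnorm (x.2 - y.2).
Proof. by rewrite eucl_dist_sqr opp_row_mx add_row_mx sqnorm_row_mx. Qed.

Lemma pdist_cell_map (R : realType) (p q : 'I_3 -> 'rV[R]_2) N
    (c : seq (word N * word N)) x y :
  pdist (cell_map p q c x) (cell_map p q c y)
    = (2^-1 ^+ N) ^+ size c * pdist x y.
Proof.
elim: c => [|we c IH] /=; first by rewrite mul1r.
rewrite exprS -mulrA -IH.
apply/eqP; rewrite -(@eqrXn2 _ 2) ?mulr_ge0 ?exprn_ge0 ?eucl_dist_ge0 //.
rewrite exprMn !pdist_sqr /= /word_map !foldr_half_mapB !size_tuple !sqnormZ.
by rewrite mulrDr.
Qed.

Lemma cell_map_gasket (R : realType) (p q : 'I_3 -> 'rV[R]_2) SG1 SG2 N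
    (c : seq (word N * word N)) x :
  is_gasket p SG1 -> is_gasket q SG2 ->
  (SG1 `*` SG2) x -> (SG1 `*` SG2) (cell_map p q c x).
Proof.
move=> g1 g2 xX; elim: c => //= we c [IH1 IH2].
by split; apply: gasket_foldr.
Qed.

Lemma gasket_cell_map (R : realType) (p q : 'I_3 -> 'rV[R]_2) SG1 SG2 N n x :
  is_gasket p SG1 -> is_gasket q SG2 -> (SG1 `*` SG2) x ->
  exists (c : n.-tuple (N.-tuple 'I_3 * N.-tuple 'I_3)) x',
    (SG1 `*` SG2) x' /\ x = cell_map p q c x'.
Proof.
move=> g1 g2; elim: n x => [|n IH] x xX; first by exists [tuple], x.
case: x xX => x1 x2 [/= /(gasket_word N g1)[w [t [tSG ->]]]].
move=> /(gasket_word N g2)[e [t' [t'SG ->]]].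
have [c [x' [x'X E]]] := IH (t, t') (conj tSG t'SG).
by exists [tuple of (w, e) :: c], x'; rewrite /= /cell_map /= -/(cell_map _ _ _ _) -E.
Qed.

(** Invariance puts the image of [(x, f x)] back on the graph, which has a single value over each
    point. *)
Lemma fif_equation (R : realType) (p q : 'I_3 -> 'rV[R]_2) SG1 SG2 N z
    (alpha h : word N -> word N -> 'rV[R]_2 * 'rV[R]_2 -> R) f w e x :
  is_fif p q SG1 SG2 z alpha h f -> (SG1 `*` SG2) x ->
  f (word_map p w x.1, word_map q e x.2) = alpha w e x * f x + h w e x.
Proof.
move=> [_ _ [_ _ _ inv _]] xX.
have : (\bigcup_we (fif_map p q alpha h we @` graph_on (SG1 `*` SG2) f))
    ((word_map p w x.1, word_map q e x.2), alpha w e x * f x + h w e x).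
  by exists (w, e) => //; exists (x, f x) => //; exists x.
by rewrite -inv => -[y _ [<- ->]].
Qed.

Lemma fif_bounded (R : realType) (p q : 'I_3 -> 'rV[R]_2) SG1 SG2 N z
    (alpha h : word N -> word N -> 'rV[R]_2 * 'rV[R]_2 -> R) f :
  is_gasket p SG1 -> is_gasket q SG2 -> is_fif p q SG1 SG2 z alpha h f ->
  exists B, forall x, (SG1 `*` SG2) x -> `|f x| <= B.
Proof.
move=> [_ _ c1 _ _] [_ _ c2 _ _] [fc _ _].
have := compact_bounded (continuous_compact fc (compact_setX c1 c2)).
move=> [M [_ /(_ (M + 1))]]; rewrite ltrDl ltr01 => /(_ isT) H.
by exists (M + 1) => x xX; apply: H; exists x.
Qed.

(* One step of the self-referential equation turns the bound C th^n on the
   oscillation of f over cells of level n into a C th^n + K th^n, and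
   C is chosen so large that a C + K <= C th; this needs a < th. *)
Lemma fif_oscillation (R : realType) (p q : 'I_3 -> 'rV[R]_2) SG1 SG2 N z
    (alpha h : word N -> word N -> 'rV[R]_2 * 'rV[R]_2 -> R) f
    (a s K_h K_alpha s_h : R) (s_alpha : word N -> word N -> R) :
  is_gasket p SG1 -> is_gasket q SG2 -> is_fif p q SG1 SG2 z alpha h f ->
  (forall x y, (SG1 `*` SG2) x -> (SG1 `*` SG2) y -> pdist x y <= 1) ->
  (forall w e x, (SG1 `*` SG2) x -> `|alpha w e x| <= a) ->
  a < 2^-1 ^+ N -> s <= 1 -> s <= s_h -> 0 <= s_h ->
  (forall w e, s <= s_alpha w e) -> (forall w e, 0 <= s_alpha w e) ->
  (forall w e, hoelder_on (SG1 `*` SG2) (h w e) K_h s_h) ->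
  (forall w e, hoelder_on (SG1 `*` SG2) (alpha w e) K_alpha (s_alpha w e)) ->
  exists2 C, 0 <= C & forall (c : seq (word N * word N)) x y,
    (SG1 `*` SG2) x -> (SG1 `*` SG2) y ->
    `|f (cell_map p q c x) - f (cell_map p q c y)|
      <= C * ((2^-1 ^+ N) `^ s) ^+ size c.
Proof.
move=> g1 g2 hf diam alpha_le a_lt s1 s_le_h sh0 s_le_alpha sa0 h_h h_alpha.
have [B0 fB0] := fif_bounded g1 g2 hf.
pose B := `|B0|.
have fB x : (SG1 `*` SG2) x -> `|f x| <= B.
  by move=> /fB0 /le_trans; apply; exact: ler_norm.
have B0_ge0 : 0 <= B by exact: normr_ge0.
set rho : R := 2^-1 ^+ N.
have rho0 : 0 < rho by rewrite exprn_gt0 // invr_gt0.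
have rho1 : rho <= 1 by rewrite exprn_ile1 // invf_le1 // ler1n.
set th := rho `^ s.
have rho_th : rho <= th.
  rewrite -[leLHS](powRr1 (ltW rho0)); apply: ger_powR => //.
  by rewrite rho0.
have a_th : a < th by exact: lt_le_trans rho_th.
have th0 : 0 < th by exact: powR_gt0.
pose K := `|K_alpha| * B + `|K_h|.
have K0 : 0 <= K by rewrite addr_ge0 ?mulr_ge0.
(* The first summand yields C (th - a) >= K for the induction step; the second bounds the
   oscillation at level 0. *)
pose C := K / (th - a) + 2 * B.
have Kth0 : 0 <= K / (th - a) by rewrite divr_ge0 // subr_ge0 ltW.
have C0 : 0 <= C by rewrite addr_ge0 // mulr_ge0.
have CK : a * C + K <= C * th.
  have KE : K = K / (th - a) * (th - a).
    by rewrite divfK // gt_eqF // subr_gt0.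
  have := mulr_ge0 B0_ge0 (ltW (_ : 0 < th - a)); rewrite subr_gt0 => /(_ a_th).
  by rewrite [in X in _ -> X <= _]KE /C; nra.
exists C => // c x y xX yX; elim: c => [|[w e] c IH].
  rewrite mulr1 /=; apply: (@le_trans _ _ (2 * B)); last by rewrite lerDr.
  apply: (le_trans (ler_normB _ _)).
  by have := fB x xX; have := fB y yX; lra.
set u := cell_map p q c x in IH *; set v := cell_map p q c y in IH *.
have uX : (SG1 `*` SG2) u by exact: cell_map_gasket.
have vX : (SG1 `*` SG2) v by exact: cell_map_gasket.
rewrite /= -/u -/v !(fif_equation _ _ hf) //.
have -> : alpha w e u * f u + h w e u - (alpha w e v * f v + h w e v)
  = alpha w e u * (f u - f v) + ((alpha w e u - alpha w e v) * f v
    + (h w e u - h w e v)) by ring.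
(* Cells of level n have diameter at most rho^n <= 1, so an exponent above [s] only improves the
   bound. *)
have powle t : s <= t -> 0 <= t -> pdist u v `^ t <= th ^+ size c.
  move=> st t0; apply: (@le_trans _ _ ((rho ^+ size c) `^ t)).
    apply: ge0_ler_powR; rewrite ?nnegrE ?eucl_dist_ge0 ?exprn_ge0 ?(ltW rho0) //.
    rewrite pdist_cell_map ler_piMr ?exprn_ge0 ?(ltW rho0) //.
    exact: diam.
  apply: (@le_trans _ _ ((rho ^+ size c) `^ s)).
    apply: ger_powR => //; rewrite exprn_gt0 //=.
    by rewrite exprn_ile1 // ltW.
  rewrite -[rho ^+ _]powR_mulrn ?(ltW rho0) // -powRrM mulrC powRrM powR_mulrn //.
  exact: powR_ge0.
have hh : `|h w e u - h w e v| <= `|K_h| * th ^+ size c.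
  apply: (le_trans (h_h w e u v uX vX)).
  apply: (@le_trans _ _ (`|K_h| * pdist u v `^ s_h)).
    by rewrite ler_wpM2r ?powR_ge0 // ler_norm.
  by rewrite ler_wpM2l // powle.
have ha : `|alpha w e u - alpha w e v| <= `|K_alpha| * th ^+ size c.
  apply: (le_trans (h_alpha w e u v uX vX)).
  apply: (@le_trans _ _ (`|K_alpha| * pdist u v `^ s_alpha w e)).
    by rewrite ler_wpM2r ?powR_ge0 // ler_norm.
  by rewrite ler_wpM2l // powle.
apply: (le_trans (ler_normD _ _)).
apply: (@le_trans _ _ (a * (C * th ^+ size c) + (`|K_alpha| * th ^+ size c * B
    + `|K_h| * th ^+ size c))).
  apply: lerD; first by rewrite normrM ler_pM // alpha_le.
  apply: (le_trans (ler_normD _ _)); apply: lerD => //.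
  by rewrite normrM ler_pM // fB.
have -> : a * (C * th ^+ size c) + (`|K_alpha| * th ^+ size c * B
    + `|K_h| * th ^+ size c) = (a * C + K) * th ^+ size c by rewrite /K; ring.
by rewrite exprS mulrA ler_wpM2r // exprn_ge0 // ltW.
Qed.

Lemma covering_number_le_card (R : realType) n (A : set 'rV[R]_n) (x : R)
    (T : finType) (U : T -> set 'rV[R]_n) :
  A `<=` \bigcup_i U i -> (forall i, (ediam (U i) <= x%:E)%E) ->
  (covering_number A x <= #|T|%:R%:E)%E.
Proof.
move=> AU Ux; apply: ereal_inf_lbound; exists #|T| => //.
exists (fun i => U (enum_val i)); split=> // y /AU[i _ Uiy].
by exists (enum_rank i) => //; rewrite enum_rankK.
Qed.

Lemma covering_number_anti (R : realType) n (A : set 'rV[R]_n) (x y : R) :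
  x <= y -> (covering_number A y <= covering_number A x)%E.
Proof.
move=> xy; apply: ereal_inf_le_tmp => _ [k [U [AU Ux]] <-]; exists k => //.
by exists U; split=> // i; apply: le_trans (Ux i) _; rewrite lee_fin.
Qed.

Lemma sqnorm_to_space5B (R : realType) (u v : 'rV[R]_2 * 'rV[R]_2 * R) :
  sqnorm (to_space5 u - to_space5 v) = pdist u.1 v.1 ^+ 2 + (u.2 - v.2) ^+ 2.
Proof.
rewrite /to_space5 !opp_row_mx !add_row_mx !sqnorm_row_mx -pdist_sqr.
by congr (_ + _); rewrite -raddfB /sqnorm big_ord_recl big_ord0 addr0 mxE.
Qed.

Lemma Gr_covering_number (R : realType) (p q : 'I_3 -> 'rV[R]_2) SG1 SG2 N f C th :
  is_gasket p SG1 -> is_gasket q SG2 ->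
  (forall x y, (SG1 `*` SG2) x -> (SG1 `*` SG2) y -> pdist x y <= 1) ->
  0 <= C -> 2^-1 ^+ N <= th ->
  (forall (c : seq (word N * word N)) x y,
     (SG1 `*` SG2) x -> (SG1 `*` SG2) y ->
     `|f (cell_map p q c x) - f (cell_map p q c y)| <= C * th ^+ size c) ->
  forall n, (covering_number (Gr SG1 SG2 f) (2 * (2^-1 ^+ N) ^+ n)
    <= (9 ^+ (N * n) * ((2 * C + 1) * (th ^+ n / (2^-1 ^+ N) ^+ n)))%:E)%E.
Proof.
move=> g1 g2 diam C0 rho_th osc n.
set rho : R := 2^-1 ^+ N in rho_th *.
have rho0 : 0 < rho by rewrite exprn_gt0 // invr_gt0.
set r := rho ^+ n; have r0 : 0 < r by rewrite exprn_gt0.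
have r_th : r <= th ^+ n by rewrite lerXn2r // ?nnegrE ?(ltW rho0) ?(le_trans (ltW rho0)).
have [t1 t1SG] := gasket_nonempty g1; have [t2 t2SG] := gasket_nonempty g2.
have x0X : (SG1 `*` SG2) (t1, t2) by [].
(* A lower bound for [f] on the cell, by oscillation around the image of a base point; the values on
   the cell fill an interval of length at most 2 C th^n, cut below into [k] slices of height [r]. *)
pose low (c : seq (word N * word N)) := f (cell_map p q c (t1, t2)) - C * th ^+ n.
pose k := (Num.trunc (2 * (C * th ^+ n) / r)).+1.
pose T := (n.-tuple (N.-tuple 'I_3 * N.-tuple 'I_3) * 'I_k)%type.
have Cth0 : 0 <= C * th ^+ n by rewrite mulr_ge0 // (le_trans (ltW r0)).
pose U (i : T) : set 'rV[R]_(2 + 2 + 1) :=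
  [set y | exists x, [/\ (SG1 `*` SG2) x,
     y = to_space5 (cell_map p q i.1 x, f (cell_map p q i.1 x)) &
     low i.1 + i.2%:R * r <= f (cell_map p q i.1 x) <= low i.1 + i.2.+1%:R * r]].
apply: (@le_trans _ _ #|{: T}|%:R%:E).
  apply: (@covering_number_le_card _ _ _ _ _ U).
    move=> _ [_ [x xX <-] <-].
    have [c [x' [x'X ->]]] := gasket_cell_map N n g1 g2 xX.
    have := osc c x' (t1, t2) x'X x0X; rewrite size_tuple ler_norml => /andP[osc1 osc2].
    have y0 : 0 <= (f (cell_map p q c x') - low c) / r.
      by rewrite divr_ge0 ?(ltW r0) // /low; lra.
    have jk : (Num.trunc ((f (cell_map p q c x') - low c) / r) < k)%N.
      rewrite ltnS le_truncn // ler_pM2r ?invr_gt0 //.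
      by rewrite /low; lra.
    exists (c, Ordinal jk) => //; exists x'; split => //=.
    have /andP[] := truncn_itv y0.
    rewrite ler_pdivlMr // ltr_pdivrMr // => j1 j2.
    by apply/andP; split; lra.
  move=> i; apply: ge_ereal_sup => _ [[u v] [/= [x [xX Eu hx]] [y [yX Ev hy]]] <-].
  rewrite {}Eu {}Ev.
  rewrite lee_fin eucl_dist_le ?mulr_ge0 ?(ltW r0) //= sqnorm_to_space5B /=.
  rewrite pdist_cell_map size_tuple -/rho -/r.
  have d1 : (r * pdist x y) ^+ 2 <= r ^+ 2.
    rewrite exprMn ler_piMr ?exprn_ge0 ?(ltW r0) // exprn_ile1 ?eucl_dist_ge0 //.
    exact: diam.
  have d2 : (f (cell_map p q i.1 x) - f (cell_map p q i.1 y)) ^+ 2 <= r ^+ 2.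
    rewrite -real_normK ?num_real // lerXn2r ?nnegrE ?(ltW r0) //.
    move: hx hy; rewrite -!natr1 ler_norml => /andP[? ?] /andP[? ?].
    by apply/andP; split; lra.
  by have := sqr_ge0 r; lra.
rewrite lee_fin card_prod card_tuple card_prod !card_tuple !card_ord natrM.
rewrite natrX -expnMn natrX -exprM ler_wpM2l ?exprn_ge0 //.
have y0 : 0 <= 2 * (C * th ^+ n) / r.
  by rewrite divr_ge0 ?(ltW r0) // mulr_ge0.
have /andP[tr _] := truncn_itv y0; rewrite -[k%:R]natr1; apply: (le_trans (lerD tr (lexx 1))).
(* The extra slice from rounding up is absorbed because r <= th^n. *)
have : 1 <= th ^+ n / r by rewrite ler_pdivlMr // mul1r.
lra.
Qed.

(** * Extremal parameters, passage to all scales, and the three inequalities *)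

Lemma max_sup_norm_ge0 (R : realType) N A
    (alpha : word N -> word N -> 'rV[R]_2 * 'rV[R]_2 -> R) :
  (0 <= max_sup_norm A alpha)%E.
Proof. exact: bigmax_ge_id. Qed.

Lemma max_sup_norm_ge (R : realType) N A
    (alpha : word N -> word N -> 'rV[R]_2 * 'rV[R]_2 -> R) w e x :
  A x -> (`|alpha w e x|%:E <= max_sup_norm A alpha)%E.
Proof.
move=> Ax; apply: (@le_trans _ _ (sup_norm A (alpha w e))).
  by apply: ereal_sup_ubound; exists x.
apply: le_trans (le_bigmax_cond _ _ (isT : (fun _ => true) w)).
exact: (le_bigmax_cond _ _ (isT : (fun _ => true) e)).
Qed.

Lemma min_exponent_le (R : realType) N (b : word N -> word N -> R) w e :
  min_exponent b <= b w e.
Proof.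
apply: le_trans (bigmin_le_cond _ _ (isT : (fun _ => true) w)) _.
exact: (bigmin_le_cond _ _ (isT : (fun _ => true) e)).
Qed.

(** With r = rho^n for rho = 2^-N, the factors are 9^(N n) = r^-D and (rho^s)^n / rho^n =
    r^(s-1). *)
Lemma covering_bound_powR (R : realType) N n (s C : R) :
  9 ^+ (N * n) * (C * (((2^-1 ^+ N) `^ s) ^+ n / (2^-1 ^+ N) ^+ n))
  = C * ((2^-1 ^+ N) ^+ n) `^ (- (1 - s + 2 * (ln 3 / ln 2))).
Proof.
have r0 : 0 < (2^-1 ^+ N) ^+ n :> R by rewrite !exprn_gt0 // invr_gt0.
have rD (x y : R) : ((2^-1 ^+ N) ^+ n) `^ (x + y)
    = ((2^-1 ^+ N) ^+ n) `^ x * ((2^-1 ^+ N) ^+ n) `^ y.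
  by rewrite powRD // (gt_eqF r0) implybT.
rewrite opprD rD opprB rD powR_inv1 ?(ltW r0) // mulrCA; congr (_ * _).
rewrite mulrC; congr (_ * _ * _).
  rewrite -[X in _ = X `^ s]powR_mulrn ?exprn_ge0 // -powRrM mulrC powRrM.
  by rewrite powR_mulrn // powR_ge0.
by rewrite powRN -exprM half_powR exprVn invrK.
Qed.

(** Choosing r^(n+1) < x / 2 <= r^n, monotonicity reduces [x] to the scale 2 r^(n+1), and r^(n+1) >=
    (r / 2) x costs only the factor (r / 2)^-E. *)
Lemma covering_number_powR (R : realType) d (A : set 'rV[R]_d) (r C E : R) :
  0 < r < 1 -> 0 <= C -> 0 <= E ->
  (forall n, (covering_number A (2 * r ^+ n) <= (C * (r ^+ n) `^ (- E))%:E)%E) ->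
  forall x, 0 < x < 1 ->
    (covering_number A x <= (C * (r / 2) `^ (- E) * x `^ (- E))%:E)%E.
Proof.
move=> r01 C0 E0 H x /andP[x0 x1]; have /andP[r0 _] := r01.
have [||n /andP[n1 n2]] := @geometric_bracket R r (x / 2) => //.
  by apply/andP; split; lra.
apply: (@le_trans _ _ (covering_number A (2 * r ^+ n.+1))).
  by apply: covering_number_anti; lra.
apply: (le_trans (H _)); rewrite lee_fin -mulrA ler_wpM2l //.
have rx0 : 0 < r / 2 * x by rewrite !mulr_gt0 // invr_gt0.
rewrite -powRM ?(ltW x0) ?divr_ge0 ?(ltW r0) // !powRN.
rewrite lef_pV2 ?posrE ?powR_gt0 ?exprn_gt0 //.
apply: ge0_ler_powR; rewrite ?nnegrE ?exprn_ge0 ?(ltW r0) ?(ltW rx0) //.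
by rewrite exprS -mulrA ler_pM2l // mulrC.
Qed.

Unset Implicit Arguments.

Theorem theorem4p1 (R : realType) (N : nat) (hN : (1 <= N)%N)
  (p q : 'I_3 -> 'rV[R]_2) (hp : equilateral p) (hq : equilateral q)
  (SG1 SG2 : set 'rV[R]_2) (hSG1 : is_gasket p SG1) (hSG2 : is_gasket q SG2)
  (hdist : forall x y, (SG1 `*` SG2) x -> (SG1 `*` SG2) y -> pdist x y <= 1)
  (z : 'rV[R]_2 * 'rV[R]_2 -> R)
  (hz : forall y, vertices p q N y -> product_boundary p q SG1 SG2 y -> z y = 0)
  (alpha h : word N -> word N -> 'rV[R]_2 * 'rV[R]_2 -> R)
  (halpha_cont : forall w e, {within SG1 `*` SG2, continuous (alpha w e)})
  (halpha_lt1 : forall w e, (sup_norm (SG1 `*` SG2) (alpha w e) < 1)%E)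
  (hM1 : matching1 p SG2 h) (hM2 : matching2 q SG1 h) (hM3 : matching3 p q h)
  (f : 'rV[R]_2 * 'rV[R]_2 -> R)
  (hf : is_fif p q SG1 SG2 z alpha h f)
  (K_h K_alpha s_h : R) (s_alpha : word N -> word N -> R)
  (hs_h : 0 < s_h <= 1) (hs_alpha : forall w e, 0 < s_alpha w e <= 1)
  (hh_hoelder : forall w e, hoelder_on (SG1 `*` SG2) (h w e) K_h s_h)
  (halpha_hoelder : forall w e,
     hoelder_on (SG1 `*` SG2) (alpha w e) K_alpha (s_alpha w e))
  (hsmall : (max_sup_norm (SG1 `*` SG2) alpha < (1 / 2 ^+ N)%:E)%E) :
  let s := Num.min s_h (min_exponent s_alpha) in
  [/\ ((2 * (ln 3 / ln 2))%:E <= hausdorff_dim (Gr SG1 SG2 f))%E,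
      (hausdorff_dim (Gr SG1 SG2 f) <= upper_box_dim (Gr SG1 SG2 f))%E &
      (upper_box_dim (Gr SG1 SG2 f) <= (1 - s + 2 * (ln 3 / ln 2))%:E)%E].
Proof.
have [t1 t1SG] := gasket_nonempty hSG1; have [t2 t2SG] := gasket_nonempty hSG2.
split.
- have split5 (y : 'rV[R]_(2 + 2 + 1)) : sqnorm y =
      sqnorm (lsubmx (lsubmx y)) + sqnorm (rsubmx (lsubmx y)) + sqnorm (rsubmx y).
    by rewrite -!sqnorm_row_mx !hsubmxK.
  apply: (@hausdorff_dim_ge R p q SG1 SG2 _ _ (fun y => lsubmx (lsubmx y))
    (fun y => rsubmx (lsubmx y))) => //.
  (* Freezing the other coordinate turns the diameter bound on the product into one for each
     gasket. *)
  + move=> x y xX yX; rewrite (le_trans _ (_ : pdist (x, t2) (y, t2) ^+ 2 <= 1)) //.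
      by rewrite pdist_sqr lerDl sqnorm_ge0.
    by rewrite exprn_ile1 ?eucl_dist_ge0 // hdist.
  + move=> x y xX yX; rewrite (le_trans _ (_ : pdist (t1, x) (t1, y) ^+ 2 <= 1)) //.
      by rewrite pdist_sqr lerDr sqnorm_ge0.
    by rewrite exprn_ile1 ?eucl_dist_ge0 // hdist.
  + move=> x y; rewrite -!raddfB [leRHS]split5 -addrA lerDl.
    by rewrite addr_ge0 ?sqnorm_ge0.
  + move=> x y; rewrite -!raddfB [leRHS]split5 addrAC lerDr.
    by rewrite addr_ge0 ?sqnorm_ge0.
  + move=> x1 x2 x1SG x2SG; exists (to_space5 ((x1, x2), f (x1, x2))).
      by exists ((x1, x2), f (x1, x2)) => //; exists (x1, x2).
    by rewrite /to_space5 !row_mxKl row_mxKr.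
- apply: hausdorff_dim_le_upper_box_dim.
  exists (to_space5 ((t1, t2), f (t1, t2))), ((t1, t2), f (t1, t2)) => //.
  by exists (t1, t2).
set s := Num.min _ _; have /andP[sh0 sh1] := hs_h.
have s_le_h : s <= s_h by rewrite ge_min lexx.
have s1 : s <= 1 by exact: le_trans s_le_h sh1.
have s_le_alpha w e : s <= s_alpha w e.
  by apply: le_trans (min_exponent_le s_alpha w e); rewrite ge_min lexx orbT.
have sa0 w e : 0 <= s_alpha w e by have /andP[/ltW] := hs_alpha w e.
have a_fin : max_sup_norm (SG1 `*` SG2) alpha \is a fin_num.
  by rewrite ge0_fin_numE ?max_sup_norm_ge0 // (lt_trans hsmall) // ltry.
set a := fine (max_sup_norm (SG1 `*` SG2) alpha).
have alpha_le w e x : (SG1 `*` SG2) x -> `|alpha w e x| <= a.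
  by move=> xX; rewrite -lee_fin fineK // max_sup_norm_ge.
have a_lt : a < 2^-1 ^+ N by rewrite -lte_fin fineK // exprVn -div1r.
have [C C0 osc] := fif_oscillation hSG1 hSG2 hf hdist alpha_le a_lt s1 s_le_h
  (ltW sh0) s_le_alpha sa0 hh_hoelder halpha_hoelder.
have rho0 : 0 < 2^-1 ^+ N :> R by rewrite exprn_gt0 // invr_gt0.
(* Here N >= 1 enters: the scales rho^n must tend to 0. *)
have rho1 : 2^-1 ^+ N < 1 :> R.
  by rewrite exprn_ilt1 ?invf_lt1 ?ltr1n // -lt0n.
have rho_th : 2^-1 ^+ N <= (2^-1 ^+ N) `^ s :> R.
  rewrite -[leLHS](powRr1 (ltW rho0)); apply: ger_powR => //.
  by rewrite rho0 ltW.
have cov := Gr_covering_number hSG1 hSG2 hdist C0 rho_th osc.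
have E0 : 0 <= 1 - s + 2 * (ln 3 / ln 2) :> R.
  by rewrite addr_ge0 ?subr_ge0 // mulr_ge0 // divr_ge0 // ln_ge0 // ler1n.
have C1 : 0 < 2 * C + 1 by rewrite ltr_wpDl // mulr_ge0.
(* The factor 2 C + 1 counts slices, and the power of rho / 2 is the cost of interpolating between
   the scales 2 rho^n. *)
apply: (@upper_box_dim_le _ _ _
  ((2 * C + 1) * (2^-1 ^+ N / 2) `^ (- (1 - s + 2 * (ln 3 / ln 2))))).
  by rewrite mulr_gt0 // powR_gt0 // divr_gt0.
apply: covering_number_powR => //; first by rewrite rho0.
  exact: ltW.
by move=> n; rewrite -covering_bound_powR; exact: cov.
Qed.
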